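(* Let $n,m\in\mathbb N$, let $\boldsymbol\alpha=(\alpha_1,\alpha_2,\alpha_3)\in\mathbb R^3$ with $\alpha_i>-1$ for $i=1,2,3$, and let $\boldsymbol c=(c_1,c_2,c_3)\in\mathbb N^3$ with $|\boldsymbol c|<m$. Let real coefficients $r_{\boldsymbol k}$ and positive real weights $\omega_{\boldsymbol k}$, $\boldsymbol k\in\Theta_n$, be given, and consider the rational function on $T$ $$\mathsf R_n(\boldsymbol x):=\frac{\mathsf Q_n(\boldsymbol x)}{\omega(\boldsymbol x)}=\frac{\sum_{\boldsymbol k\in\Theta_n}\omega_{\boldsymbol k}r_{\boldsymbol k}B^n_{\boldsymbol k}(\boldsymbol x)}{\sum_{\boldsymbol k\in\Theta_n}\omega_{\boldsymbol k}B^n_{\boldsymbol k}(\boldsymbol x)} .$$ Let real numbers $g_{\boldsymbol k}$, $\boldsymbol k\in\Gamma^{\boldsymbol c}_m$, be prescribed. Then the coefficients $p_{\boldsymbol k}$ of the degree $m$ polynomial $$\mathsf P_m(\boldsymbol x):=\sum_{\boldsymbol k\in\Theta_m}p_{\boldsymbol k}B^m_{\boldsymbol k}(\boldsymbol x)$$ minimising the error $$\|\mathsf R_n-\mathsf P_m\|^2_{L_2}:=\langle \mathsf R_n-\mathsf P_m,\mathsf R_n-\mathsf P_m\rangle_{\boldsymbol\alpha}$$ subject to the constraints $$p_{\boldsymbol k}=g_{\boldsymbol k}\quad\text{for }\boldsymbol k\in\Gamma^{\boldsymbol c}_m,$$ are given by $$p_{\boldsymbol k}=\sum_{\boldsymbol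 l\in\Omega^{\boldsymbol c}_m}\binom{m}{\boldsymbol l}\,E^{\boldsymbol k}_{\boldsymbol l}(\boldsymbol\alpha,\boldsymbol c,m)\,\bigl(u_{\boldsymbol l}-v_{\boldsymbol l}\bigr),\qquad \boldsymbol k\in\Omega^{\boldsymbol c}_m,$$ where $$u_{\boldsymbol l}:=\sum_{\boldsymbol h\in\Theta_n}\binom{n}{\boldsymbol h}\binom{n+m}{\boldsymbol h+\boldsymbol l}^{-1}\omega_{\boldsymbol h}r_{\boldsymbol h}\,I_{\boldsymbol h+\boldsymbol l},$$ $$v_{\boldsymbol l}:=\frac{1}{(|\boldsymbol\alpha|+3)_{2m}}\sum_{\boldsymbol h\in\Gamma^{\boldsymbol c}_m}\binom{m}{\boldsymbol h}\left(\prod_{i=1}^{3}(\alpha_i+1)_{h_i+l_i}\right)g_{\boldsymbol h},$$ with $\boldsymbol h=(h_1,h_2)$, $\boldsymbol l=(l_1,l_2)$, and (in the formula for $v_{\boldsymbol l}$) $h_3:=m-|\boldsymbol h|$, $l_3:=m-|\boldsymbol l|$, and $$I_{\boldsymbol j}:=\iint_T w_{\boldsymbol\alpha}(\boldsymbol x)\frac{B^{n+m}_{\boldsymbol j}(\boldsymbol x)}{\omega(\boldsymbol x)}\,\mathrm d\boldsymbol x,\qquad \boldsymbol j\in\Omega^{\boldsymbol c}_{n+m}.$$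
   Context: Here $\mathbb N$ includes $0$, and $|\boldsymbol y|:=y_1+\dots+y_d$ for $\boldsymbol y=(y_1,\dots,y_d)\in\mathbb R^d$ (sum of the components, without absolute values). $T:=\{(x_1,x_2):x_1,x_2\ge0,\ x_1+x_2\le1\}$ is the standard triangle. $\Pi^2_N$ is the space of all real polynomials in two variables of total degree at most $N$. Index sets: for $N\in\mathbb N$ and $\boldsymbol c=(c_1,c_2,c_3)\in\mathbb N^3$ with $|\boldsymbol c|<N$, $\Theta_N:=\{\boldsymbol k=(k_1,k_2)\in\mathbb N^2: 0\le|\boldsymbol k|\le N\}$, $\Omega^{\boldsymbol c}_N:=\{\boldsymbol k=(k_1,k_2)\in\mathbb N^2: k_1\ge c_1,\ k_2\ge c_2,\ |\boldsymbol k|\le N-c_3\}$, $\Gamma^{\boldsymbol c}_N:=\Theta_N\setminus\Omega^{\boldsymbol c}_N$. For $\boldsymbol k=(k_1,k_2)\in\Theta_N$, $\binom{N}{\boldsymbol k}:=\frac{N!}{k_1!\,k_2!\,(N-|\boldsymbol k|)!}$. The shifted factorial is $(a)_0:=1$, $(a)_k:=a(a+1)\cdots(a+k-1)$ for $k\ge1$. Bernstein polynomials: $B^N_{\boldsymbol k}(\boldsymbol x):=\binom{N}{\boldsymbol k}x_1^{k_1}x_2^{k_2}(1-|\boldsymbol x|)^{N-|\boldsymbol k|}$, $\boldsymbol k\in\Theta_N$, $\boldsymbol x=(x_1,x_2)$. Inner product: $\langle f,g\rangle_{\boldsymbol\alpha}:=\iint_T w_{\boldsymbol\alpha}(\boldsymbol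 x)f(\boldsymbol x)g(\boldsymbol x)\,\mathrm d\boldsymbol x$, where $w_{\boldsymbol\alpha}(\boldsymbol x):=A_{\boldsymbol\alpha}x_1^{\alpha_1}x_2^{\alpha_2}(1-|\boldsymbol x|)^{\alpha_3}$ and $A_{\boldsymbol\alpha}:=\Gamma(|\boldsymbol\alpha|+3)/[\Gamma(\alpha_1+1)\Gamma(\alpha_2+1)\Gamma(\alpha_3+1)]$. Constrained space: $\Pi^{\boldsymbol c,2}_m:=\{P\in\Pi^2_m: P(\boldsymbol x)=x_1^{c_1}x_2^{c_2}(1-|\boldsymbol x|)^{c_3}Q(\boldsymbol x)\text{ for some }Q\in\Pi^2_{m-|\boldsymbol c|}\}$; the polynomials $B^m_{\boldsymbol k}$, $\boldsymbol k\in\Omega^{\boldsymbol c}_m$, form a basis of it. The constrained dual bivariate Bernstein basis polynomials $D^{(m,\boldsymbol c)}_{\boldsymbol k}=D^{(m,\boldsymbol c)}_{\boldsymbol k}(\cdot;\boldsymbol\alpha)\in\Pi^{\boldsymbol c,2}_m$, $\boldsymbol k\in\Omega^{\boldsymbol c}_m$, are defined by $\langle D^{(m,\boldsymbol c)}_{\boldsymbol k},B^m_{\boldsymbol l}\rangle_{\boldsymbol\alpha}=\delta_{\boldsymbol k,\boldsymbol l}$ for $\boldsymbol k,\boldsymbol l\in\Omega^{\boldsymbol c}_m$, where $\delta_{\boldsymbol k,\boldsymbol l}$ is $1$ if $\boldsymbol k=\boldsymbol l$ and $0$ otherwise. The numbers $E^{\boldsymbol k}_{\boldsymbol l}(\boldsymbol\alpha,\boldsymbol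 c,m)$, $\boldsymbol k,\boldsymbol l\in\Omega^{\boldsymbol c}_m$, are the Bézier coefficients of these dual polynomials, i.e. they are defined by $$D^{(m,\boldsymbol c)}_{\boldsymbol k}(\boldsymbol x;\boldsymbol\alpha)=\sum_{\boldsymbol l\in\Omega^{\boldsymbol c}_m}E^{\boldsymbol k}_{\boldsymbol l}(\boldsymbol\alpha,\boldsymbol c,m)\,B^m_{\boldsymbol l}(\boldsymbol x),\qquad \boldsymbol k\in\Omega^{\boldsymbol c}_m.$$ *)

(* Defs.v *)
From HB Require Import structures.
From mathcomp Require Import all_boot all_order all_algebra finmap.
From mathcomp Require Import all_classical all_reals all_analysis.
(* The notations of mpoly and of mathcomp-analysis clash. *)
From mathcomp Require Import -(notations) mpoly.

Set Implicit Arguments.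
Unset Strict Implicit.
Unset Printing Implicit Defensive.

Import Order.TTheory GRing.Theory Num.Theory.
Import numFieldNormedType.Exports.

Local Open Scope classical_set_scope.
Local Open Scope ring_scope.

(* Triples are functions on 'I_3 and the two variables are indexed by 'I_2,
   so that all component indices start from 0 instead of 1. *)

Definition norm1 (k : nat * nat) : nat := (k.1 + k.2)%N.

Definition Theta (N : nat) : {fset nat * nat} :=
  [fset k in [seq (i, j) | i <- iota 0 N.+1, j <- iota 0 N.+1]
     | (norm1 k <= N)%N]%fset.

Definition Omega (c : 'I_3 -> nat) (N : nat) : {fset nat * nat} :=
  [fset k in Theta N
     | [&& (c 0%R <= k.1)%N, (c 1%R <= k.2)%N & (norm1 k <= N - c 2%R)%N]]%fset.

Definition Gam (c : 'I_3 -> nat) (N : nat) : {fset nat * nat} :=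
  (Theta N `\` Omega c N)%fset.

Definition addk (h l : nat * nat) : nat * nat :=
  ((h.1 + l.1)%N, (h.2 + l.2)%N).

(* (k_1, k_2, k_3) with k_3 = N - |k| *)
Definition ext (N : nat) (k : nat * nat) (i : 'I_3) : nat :=
  if i == 0 then k.1 else if i == 1 then k.2 else (N - norm1 k)%N.

Section Defs.
Variable R : realType.
Local Notation poly2 := (mpoly 2 R).

Definition tbinom (N : nat) (k : nat * nat) : R :=
  N`!%:R / (k.1`! * k.2`! * (N - norm1 k)`!)%:R.

Definition poch (a : R) (k : nat) : R := \prod_(0 <= i < k) (a + i%:R).

Definition eval2 (P : poly2) (x : R * R) : R :=
  meval (fun i : 'I_2 => if i == 0 then x.1 else x.2) P.

(* The variables x_1 and x_2, and x_3 = 1 - x_1 - x_2 *)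
Definition X1 : poly2 := mpolyX R (mnm1 (0 : 'I_2)).
Definition X2 : poly2 := mpolyX R (mnm1 (1 : 'I_2)).
Definition X3 : poly2 := 1 - (X1 + X2).

(* msize is the total degree plus one *)
Definition Pi2 (N : nat) : set poly2 := [set P | (msize P <= N.+1)%N].

Definition Pi2c (c : 'I_3 -> nat) (m : nat) : set poly2 :=
  [set P | Pi2 m P /\
     exists2 Q, Pi2 (m - \sum_(i < 3) c i) Q &
                P = X1 ^+ c 0 * X2 ^+ c 1 * X3 ^+ c 2 * Q].

Definition bern (N : nat) (k : nat * nat) : poly2 :=
  tbinom N k *: (X1 ^+ k.1 * X2 ^+ k.2 * X3 ^+ (N - norm1 k)).

Definition triangle : set (R * R) :=
  [set x | 0 <= x.1 /\ 0 <= x.2 /\ x.1 + x.2 <= 1].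

Definition Gamma (s : R) : R :=
  \int[@lebesgue_measure R]_(t in `]0, +oo[) (t `^ (s - 1) * expR (- t)).

Definition integral_T (f : R * R -> R) : R :=
  \int[(@lebesgue_measure R \x @lebesgue_measure R)%E]_(x in triangle) f x.

Definition Acoef (alpha : 'I_3 -> R) : R :=
  Gamma (\sum_(i < 3) alpha i + 3) / \prod_(i < 3) Gamma (alpha i + 1).

Definition weight (alpha : 'I_3 -> R) (x : R * R) : R :=
  Acoef alpha * x.1 `^ alpha 0 * x.2 `^ alpha 1 * (1 - (x.1 + x.2)) `^ alpha 2.

Definition inner (alpha : 'I_3 -> R) (f g : R * R -> R) : R :=
  integral_T (fun x => weight alpha x * f x * g x).

Definition dual_bernstein (alpha : 'I_3 -> R) (c : 'I_3 -> nat) (m : nat)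
    (D : nat * nat -> poly2) : Prop :=
  (forall k, k \in Omega c m -> Pi2c c m (D k)) /\
  (forall k l, k \in Omega c m -> l \in Omega c m ->
     inner alpha (eval2 (D k)) (eval2 (bern m l)) = (k == l)%:R).

Definition bezier_coefs (c : 'I_3 -> nat) (m : nat)
    (D : nat * nat -> poly2) (E : nat * nat -> nat * nat -> R) : Prop :=
  forall k, k \in Omega c m -> D k = \sum_(l <- Omega c m) E k l *: bern m l.

Definition bezier (N : nat) (p : nat * nat -> R) : poly2 :=
  \sum_(k <- Theta N) p k *: bern N k.

Definition rational_bezier (n : nat) (omega r : nat * nat -> R) (x : R * R) : R :=
  eval2 (bezier n (fun k => omega k * r k)) x / eval2 (bezier n omega) x.

Definition sq_error (alpha : 'I_3 -> R) (n m : nat) (omega r p : nat * nat -> R)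
    : R :=
  let e x := rational_bezier n omega r x - eval2 (bezier m p) x in
  inner alpha e e.

Definition satisfies_constraints (c : 'I_3 -> nat) (m : nat)
    (g p : nat * nat -> R) : Prop :=
  forall k, k \in Gam c m -> p k = g k.

Definition constrained_minimiser (alpha : 'I_3 -> R) (c : 'I_3 -> nat) (n m : nat)
    (omega r g p : nat * nat -> R) : Prop :=
  satisfies_constraints c m g p /\
  forall q, satisfies_constraints c m g q ->
    sq_error alpha n m omega r p <= sq_error alpha n m omega r q.

Definition I_int (alpha : 'I_3 -> R) (n m : nat) (omega : nat * nat -> R)
    (j : nat * nat) : R :=
  integral_T (fun x =>
    weight alpha x * (eval2 (bern (n + m) j) x / eval2 (bezier n omega) x)).

Definition u_coef (alpha : 'I_3 -> R) (n m : nat) (omega r : nat * nat -> R)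
    (l : nat * nat) : R :=
  \sum_(h <- Theta n)
     tbinom n h * (tbinom (n + m) (addk h l))^-1 * omega h * r h
     * I_int alpha n m omega (addk h l).

Definition v_coef (alpha : 'I_3 -> R) (c : 'I_3 -> nat) (m : nat)
    (g : nat * nat -> R) (l : nat * nat) : R :=
  (poch (\sum_(i < 3) alpha i + 3) (2 * m))^-1 *
  \sum_(h <- Gam c m)
     tbinom m h * (\prod_(i < 3) poch (alpha i + 1) (ext m h i + ext m l i)) * g h.

End Defs.

(* Main.v *)
Require Import Defs.
From mathcomp Require Import all_boot all_order all_algebra finmap.
From mathcomp Require Import all_classical all_reals all_analysis.
From mathcomp Require Import -(notations) mpoly.
From mathcomp Require Import measurable_realfun ring lra zify.
Import Order.TTheory GRing.Theory Num.Theory.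
Import numFieldNormedType.Exports.
Set Implicit Arguments.
Unset Strict Implicit.
Unset Printing Implicit Defensive.

Local Open Scope ring_scope.

(**
A constrained polynomial is an affine combination of Bernstein polynomials in
which only the coefficients indexed by [Omega c m] are free, so minimising the
error is an unconstrained quadratic problem in those coefficients. The
squared error along a perturbation is a quadratic polynomial whose linear term
is given by the inner products of the residual with the Bernstein polynomials
B_l, l in [Omega c m], and whose quadratic term is a nonnegative squared norm
([sq_error_perturbation]). Hence a feasible p is a minimiser if and only if the
residual is orthogonal to all these B_l ([constrained_minimiserP]), that is, if
and only if p solves the normal equations
  sum_(k in Omega) p_k <B_k, B_l> = <R_n, B_l> - sum_(h in Gam) g_h <B_h, B_l>.

The duality relation of the polynomials D_k says that the matrix E is a left
inverse of the Gram matrix G of the B_k, k in [Omega c m]. Transposing E G = 1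
and using the symmetry of G shows that the transpose of E is a right inverse,
so E is symmetric and is a two-sided inverse of G. The normal equations
are thus solved by p_k = sum_l b_l E_kl, where b_l is their right-hand side
([normal_equations_solution]).

It remains to compute b_l. Up to a ratio of trinomial coefficients, the product
of a Bernstein polynomial of degree n and one of degree m is a Bernstein
polynomial of degree n + m ([bernM]), which gives <R_n, B_l> as a multiple of
u_l. The products <B_h, B_l> are Dirichlet integrals ([inner_bern]), which give
v_l.

The Dirichlet integral over the triangle is obtained from Euler's integrals,
taken with values in the extended reals so that Tonelli's theorem applies
without any integrability condition. The truncated powers t_+^(a-1) satisfy the
convolution identity
  t_+^(a-1) * t_+^(b-1) = B(a, b) t_+^(a+b-1),
which follows from the change of variables s = t x ([tpow_convolution]). It
yields B(a, b) Gamma(a + b) = Gamma(a) Gamma(b) on integrating against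
exp(-t), and the two-dimensional Dirichlet integral on integrating over x_2 and
then over x_1. With B(a, 1) = 1/a, the first identity contains the functional
equation of Gamma, from which its finiteness and positivity follow.
*)

(** * Lebesgue integrals on the line *)

Section LineIntegrals.
Local Open Scope classical_set_scope.
Local Open Scope ereal_scope.
Context {R : realType}.
Local Notation mu := (@lebesgue_measure R).
Implicit Types (f : R -> \bar R).

Lemma integral_shift f (c : R) : measurable_fun [set: R] f ->
  (forall x, 0 <= f x) ->
  \int[mu]_x f (x + c)%R = \int[mu]_x f x.
Proof.
move=> mf f0.
have mphi : measurable_fun [set: measurableTypeR R]
  ((fun x : R => (x + c)%R) : _ -> measurableTypeR R).
  exact: measurable_funD.
transitivity (\int[pushforward mu
    ((fun x : R => (x + c)%R) : _ -> measurableTypeR R)]_x f x).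
  by rewrite ge0_integral_pushforward.
apply: eq_measure_integral => //= A mA _.
apply/esym/(@lebesgue_measure_unique R (pushforward mu
  ((fun x : R => (x + c)%R) : _ -> measurableTypeR R))) => //.
move=> _ [[a b]] _ <- /=.
rewrite /pushforward (_ : _ @^-1` _ = `](a - c)%R, (b - c)%R]%classic).
  rewrite !lebesgue_measure_itv/= !lte_fin ltrD2r; case: ifP => // _.
  by rewrite -!EFinB; congr EFin; rewrite opprB addrA subrK.
by apply/seteqP; split => x /=; rewrite !in_itv/= ltrBlDr lerBrDr.
Qed.

(** Uniqueness of the Lebesgue measure, for integrals: a measure that is
proportional to it on half-open intervals has proportional integrals. *)
Lemma integral_measure_scaled (nu : {measure set (measurableTypeR R) -> \bar R})
    (k : {nonneg R}) f :
  (forall X, ocitv X -> k%:num%:E * nu X = mu X) ->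
  measurable_fun [set: R] f -> (forall x, 0 <= f x) ->
  k%:num%:E * \int[nu]_x f x = \int[mu]_x f x.
Proof.
move=> knu mf f0; rewrite -ge0_integral_mscale//.
apply: eq_measure_integral => //= A mA _.
apply/esym/(@lebesgue_measure_unique R (mscale k nu)) => // X oX.
by rewrite -knu.
Qed.

Lemma integral_scale f (t : R) : (0 < t)%R -> measurable_fun [set: R] f ->
  (forall x, 0 <= f x) ->
  t%:E * \int[mu]_x f (t * x)%R = \int[mu]_x f x.
Proof.
move=> t0 mf f0.
have mphi : measurable_fun [set: measurableTypeR R]
  ((fun x : R => (t * x)%R) : _ -> measurableTypeR R).
  exact: measurable_funM.
have -> : \int[mu]_x f (t * x)%R =
    \int[pushforward mu
      ((fun x : R => (t * x)%R) : _ -> measurableTypeR R)]_x f x.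
  by rewrite ge0_integral_pushforward.
apply: (@integral_measure_scaled (pushforward mu _) (NngNum (ltW t0))) => //.
move=> _ [[a b]] _ <- /=.
rewrite /pushforward (_ : _ @^-1` _ = `](t^-1 * a)%R, (t^-1 * b)%R]%classic).
  rewrite !lebesgue_measure_itv/= !lte_fin ltr_pM2l ?invr_gt0//.
  case: ifP => // _; last by rewrite mule0.
  by rewrite -!EFinB -EFinM mulrBr !mulrA divff ?gt_eqF// !mul1r.
by apply/seteqP; split => x /=; rewrite !in_itv/= ltr_pdivrMl// ler_pdivlMl.
Qed.

Lemma eq_integral_off_point (c : R) f g : measurable_fun [set: R] f ->
  measurable_fun [set: R] g -> (forall x, 0 <= f x) -> (forall x, 0 <= g x) ->
  (forall x, x != c -> f x = g x) -> \int[mu]_x f x = \int[mu]_x g x.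
Proof.
move=> mf mg f0 g0 fg; apply: ge0_ae_eq_integral => //.
exists [set c]; split; [exact: measurable_set1|exact: lebesgue_measure_set1|].
move=> x /= /not_implyP[_ h]; apply/eqP/negPn/negP => xc.
exact/h/fg.
Qed.

End LineIntegrals.

(** * Euler integrals and convolution of truncated powers *)

Section EulerIntegrals.
Local Open Scope classical_set_scope.
Context {R : realType}.
Local Notation mu := (@lebesgue_measure R).
Implicit Types (a b c s t x : R).

(** The truncated power t_+^(a-1). The point t = 0 is included, with the value
of [powR] there, so that the weight of the closed triangle is exactly a product
of truncated powers. *)
Definition tpow a t : R := if 0 <= t then t `^ (a - 1) else 0.

(** Euler's integral of the second kind as an extended real number, for an
arbitrary real parameter. *)
Definition gamma_int a : \bar R := (\int[mu]_t (tpow a t * expR (- t))%:E)%E.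

(** Euler's integral of the first kind; the truncated powers restrict it to the
unit interval. *)
Definition beta_int a b : \bar R :=
  (\int[mu]_s (tpow a s * tpow b (1 - s))%:E)%E.

Lemma tpow_ge0 a t : 0 <= tpow a t.
Proof. by rewrite /tpow; case: ifP => // _; exact: powR_ge0. Qed.

Lemma tpow_lt0 a t : t < 0 -> tpow a t = 0.
Proof. by move=> t0; rewrite /tpow leNgt t0. Qed.

Lemma measurable_tpow a : measurable_fun [set: R] (tpow a).
Proof.
by rewrite /tpow; apply: measurable_fun_ifT => //; exact: measurable_fun_ler.
Qed.

Lemma tpowM a t x : 0 < t -> tpow a (t * x) = t `^ (a - 1) * tpow a x.
Proof.
move=> t0; rewrite /tpow pmulr_rge0//; case: ifP => x0; last by rewrite mulr0.
by rewrite powRM// ltW.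
Qed.

Lemma measurable_tpow_comp d (T : measurableType d) a (f : T -> R) :
  measurable_fun [set: T] f -> measurable_fun [set: T] (fun z => tpow a (f z)).
Proof. by move=> mf; exact: (measurableT_comp (measurable_tpow a)). Qed.

Local Open Scope ereal_scope.

Lemma gamma_int_ge0 a : 0 <= gamma_int a.
Proof.
by apply: integral_ge0 => t _; rewrite lee_fin mulr_ge0 ?tpow_ge0 ?expR_ge0.
Qed.

Lemma beta_int_ge0 a b : 0 <= beta_int a b.
Proof. by apply: integral_ge0 => t _; rewrite lee_fin mulr_ge0 ?tpow_ge0. Qed.

(** The origin is excluded: when a + b = 1 the right-hand side need not vanish
at t = 0, whereas the integrand is supported by a single point. *)
Lemma tpow_convolution a b t : t != 0%R ->
  \int[mu]_s (tpow a s * tpow b (t - s))%:E =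
    beta_int a b * (tpow (a + b) t)%:E.
Proof.
rewrite neq_lt => /orP[t0|t0].
  rewrite (tpow_lt0 _ t0) mule0; apply: integral0_eq => s _.
  have [s0|s0] := leP 0%R s.
    by rewrite [X in (_ * X)%R]tpow_lt0 ?mulr0//; lra.
  by rewrite tpow_lt0 ?mul0r.
rewrite -(integral_scale t0)//; last first.
  by move=> s; rewrite lee_fin mulr_ge0 ?tpow_ge0.
  apply/measurable_EFinP/measurable_funM; first exact: measurable_tpow.
  by apply: measurable_tpow_comp; exact: measurable_funB.
under eq_integral => s _.
  have -> : (t - t * s = t * (1 - s))%R by ring.
  rewrite !tpowM// mulrACA EFinM.
  over.
rewrite ge0_integralZl//; first last.
- by rewrite lee_fin mulr_ge0 ?powR_ge0.
- by move=> s _; rewrite lee_fin mulr_ge0 ?tpow_ge0.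
- apply/measurable_EFinP/measurable_funM; first exact: measurable_tpow.
  by apply: measurable_tpow_comp; exact: measurable_funB.
rewrite muleA -EFinM muleC; congr (_ * _%:E).
have tn0 r s : (r + s == 0)%R ==> (t != 0)%R by rewrite (gt_eqF t0) implybT.
rewrite /tpow (ltW t0) -{1}(powRr1 (ltW t0)) -!powRD//.
by congr (_ `^ _)%R; ring.
Qed.

(** The double integral of s_+^(a-1) (t - s)_+^(b-1) exp(-t) is computed in
both orders. *)
Lemma beta_gamma_int a b :
  beta_int a b * gamma_int (a + b) = gamma_int a * gamma_int b.
Proof.
pose f (z : R * R) : \bar R :=
  (tpow a z.1 * tpow b (z.2 - z.1) * expR (- z.2))%:E.
have f0 z : 0 <= f z by rewrite lee_fin !mulr_ge0 ?tpow_ge0 ?expR_ge0.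
have mf : measurable_fun [set: R * R] f.
  apply/measurable_EFinP; apply: measurable_funM; first apply: measurable_funM.
  - exact: measurable_tpow_comp.
  - by apply: measurable_tpow_comp; exact: measurable_funB.
  - by apply: measurableT_comp => //; exact: measurableT_comp.
transitivity (\int[mu]_s \int[mu]_t f (s, t)); last first.
  rewrite [X in X * _]/gamma_int -ge0_integralZr//; first last.
  - exact: gamma_int_ge0.
  - by move=> s _; rewrite lee_fin mulr_ge0 ?tpow_ge0 ?expR_ge0.
  - apply/measurable_EFinP/measurable_funM; first exact: measurable_tpow.
    exact: measurableT_comp.
  apply: eq_integral => s _.
  rewrite -(@integral_shift _ (fun t => f (s, t)) s)//; last first.
    exact: measurableT_comp.
  rewrite -ge0_integralZl//; first last.
  - by rewrite lee_fin mulr_ge0 ?tpow_ge0 ?expR_ge0.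
  - by move=> t _; rewrite lee_fin mulr_ge0 ?tpow_ge0 ?expR_ge0.
  - apply/measurable_EFinP/measurable_funM; first exact: measurable_tpow.
    exact: measurableT_comp.
  apply: eq_integral => t _; rewrite -EFinM /f/= addrK opprD expRD.
  by congr EFin; ring.
rewrite fubini_tonelli//= /gamma_int -ge0_integralZl//; first last.
- exact: beta_int_ge0.
- by move=> s _; rewrite lee_fin mulr_ge0 ?tpow_ge0 ?expR_ge0.
- apply/measurable_EFinP/measurable_funM; first exact: measurable_tpow.
  exact: measurableT_comp.
apply: (@eq_integral_off_point _ 0%R).
- apply: emeasurable_funM => //; apply/measurable_EFinP/measurable_funM.
    exact: measurable_tpow.
  exact: measurableT_comp.
- exact: measurable_fun_fubini_tonelli_G.
- move=> t; rewrite mule_ge0 ?beta_int_ge0//.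
  by rewrite lee_fin mulr_ge0 ?tpow_ge0 ?expR_ge0.
- by move=> t; apply: integral_ge0.
move=> t t0; rewrite EFinM muleA -tpow_convolution// -ge0_integralZr//;
  first last.
- by move=> s _; rewrite lee_fin mulr_ge0 ?tpow_ge0.
- apply/measurable_EFinP/measurable_funM; first exact: measurable_tpow.
  by apply: measurable_tpow_comp; exact: measurable_funB.
Qed.

End EulerIntegrals.

(** * The Gamma function *)

Section GammaFunction.
Local Open Scope classical_set_scope.
Context {R : realType}.
Local Notation mu := (@lebesgue_measure R).
Implicit Types (a b c s t x : R).

Lemma integral_powR_itv a (e : R) : 0 < a -> 0 < e <= 1 ->
  (\int[mu]_(s in `[e, 1%R]) (s `^ (a - 1))%:E)%E = (a^-1 * (1 - e `^ a))%:E.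
Proof.
move=> a0 /andP[e0]; rewrite le_eqVlt => /predU1P[->|e1].
  by rewrite set_itv1 integral_set1 powR1 subrr mulr0.
have pos x : e <= x -> x \in `]0, +oo[%R.
  by rewrite in_itv/= andbT; apply: lt_le_trans.
have dpow (p x : R) : e <= x -> derivable (fun y : R => y `^ p) x 1.
  by move=> ex; apply: derivable_powR; exact: pos.
pose F s := a^-1 * s `^ a.
have dF (x : R) : e <= x -> derivable F x 1.
  by move=> ex; apply: derivableM => //; exact: dpow.
have cF (x : R) : e <= x -> {for x, continuous F}.
  by move=> ex; apply: differentiable_continuous; exact/derivable1_diffP/dF.
rewrite (@continuous_FTC2 _ _ F) => //.
- by rewrite /F powR1 -EFinB mulrBr.
- apply: derivable_within_continuous => x; rewrite in_itv/= => /andP[ex _].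
  exact: dpow.
- split.
  + by move=> x; rewrite in_itv/= => /andP[/ltW ex _]; exact: dF.
  + by apply: cvg_at_right_filter; exact: cF.
  + by apply: cvg_at_left_filter; apply: cF; exact: ltW.
- move=> x; rewrite in_itv/= => /andP[/ltW ex _].
  rewrite derive1E /F deriveM//; last exact: dpow.
  rewrite derive_cst -derive1E powR_derive1 ?pos//.
  by rewrite scaler0 addr0 /GRing.scale/= mulrA mulVf ?mul1r ?gt_eqF.
Qed.

Local Open Scope ereal_scope.

(** The integrand may be singular at the origin, so the integral over ]0, 1] is
the limit of the integrals over [1/(n+1), 1]. *)
Lemma beta_int1r a : (0 < a)%R -> beta_int a 1 = (a^-1)%:E.
Proof.
move=> a0.
pose f s := (tpow a s * tpow 1 (1 - s))%:E.
have mf : measurable_fun [set: R] f.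
  apply/measurable_EFinP/measurable_funM; first exact: measurable_tpow.
  by apply: measurable_tpow_comp; exact: measurable_funB.
have f0 s : 0 <= f s by rewrite lee_fin mulr_ge0 ?tpow_ge0.
have -> : beta_int a 1 = \int[mu]_(s in `]0%R, 1%R]) f s.
  rewrite [RHS]integral_mkcond; apply: (@eq_integral_off_point _ 0%R) => //.
  - by apply/(measurable_restrictT f) => //; exact: measurable_funS mf.
  - by move=> s; apply: erestrict_ge0.
  move=> s s0; rewrite patchE; case: ifPn => //.
  rewrite notin_setE/= in_itv/= => /negP; rewrite negb_and -!leNgt -ltNge.
  move=> /orP[sle|s1]; rewrite /f.
  - by rewrite tpow_lt0 ?mul0r// lt_neqAle s0.
  - by rewrite [tpow 1 _]tpow_lt0 ?mulr0//; lra.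
rewrite itv_open_bnd_bigcup.
pose F := fun n : nat => `[(0 + n.+1%:R^-1)%R, 1%R]%classic : set R.
have nF : nondecreasing_seq F.
  move=> m n mn; rewrite subsetEset /F !add0r => x /=; rewrite !in_itv/=.
  move=> /andP[h ->]; rewrite andbT (le_trans _ h)// lef_pV2 ?posrE//.
  by rewrite ler_nat.
have cF : \int[mu]_(s in F i) f s @[i --> \oo] -->
    \int[mu]_(s in \bigcup_i F i) f s.
  apply: ge0_nondecreasing_set_cvg_integral => //.
  - by move=> i; exact: measurable_itv.
  - by move=> i; exact: measurable_funS mf.
rewrite -(cvg_lim _ cF)//.
apply/cvg_lim => //.
rewrite (_ : (fun i => _) = (fun n => (a^-1 * (1 - n.+1%:R^-1 `^ a))%:E));
    last first.
  apply/funext => n; rewrite -integral_powR_itv//; last first.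
    by rewrite invr_gt0 ltr0n/= invf_le1// ler1n.
  rewrite /F add0r; apply: eq_integral => s /[!inE]/=.
  rewrite in_itv/= => /andP[h s1].
  have s0 : (0 <= s)%R by rewrite (le_trans _ h).
  by rewrite /f /tpow s0 subr_ge0 s1 subrr powRr0 mulr1.
apply: cvg_EFin; first exact: nearW.
rewrite -[X in _ --> X](_ : a^-1 * (1 - 0) = a^-1)%R; last first.
  by rewrite subr0 mulr1.
apply: cvgMr; apply: cvgB; first exact: cvg_cst.
have /cvg_at_rightP h := powR_cvg0 a0.
apply: (h (fun n => n.+1%:R^-1)%R); split; last exact: cvg_harmonic.
by move=> n; rewrite invr_gt0 ltr0n.
Qed.

Lemma gamma_int1 : gamma_int 1 = 1 :> \bar R.
Proof.
rewrite -(@integral_exponential_pdf R 1)//; apply: eq_integral => t _.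
rewrite /tpow subrr powRr0; case: ifPn => t0; congr EFin.
  by rewrite exponential_pdfE// !mul1r mulN1r.
by rewrite mul0r /exponential_pdf patchE memNset//= in_itv/= andbT; exact/negP.
Qed.

(** The identity B(a, 1) Gamma(a + 1) = Gamma(a) Gamma(1) replaces an
integration by parts. *)
Lemma gamma_intD1 a : (0 < a)%R -> gamma_int (a + 1) = a%:E * gamma_int a.
Proof.
move=> a0; have := beta_gamma_int a 1.
rewrite gamma_int1 mule1 beta_int1r// => <-.
by rewrite muleA -EFinM divff ?gt_eqF// mul1e.
Qed.

Lemma gamma_int_natS_lty (n : nat) : gamma_int (n.+1%:R : R) < +oo.
Proof.
elim: n => [|n ih]; first by rewrite gamma_int1 ltry.
rewrite -[in X in gamma_int X]natr1 gamma_intD1// lte_mul_pinfty//.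
Qed.

Lemma measurable_gamma_integrand a :
  measurable_fun [set: R] (fun t => (tpow a t * expR (- t))%:E).
Proof.
apply/measurable_EFinP/measurable_funM; first exact: measurable_tpow.
exact: measurableT_comp.
Qed.

(** For a >= 1 and t >= 0, t^(a-1) is at most 1 + t^n for any integer
n >= a - 1. *)
Lemma gamma_int_ge1_lty a : (1 <= a)%R -> gamma_int a < +oo.
Proof.
move=> a1; pose n := Num.trunc a.
have an : (a - 1 <= n%:R)%R.
  by have := truncnS_gt a; rewrite -/n -natr1; lra.
apply: (@le_lt_trans _ _ (gamma_int 1 + gamma_int (n.+1%:R : R))); last first.
  by apply: lte_add_pinfty; [rewrite gamma_int1 ltry|exact: gamma_int_natS_lty].
have ig0 (b t : R) : 0 <= (tpow b t * expR (- t))%:E.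
  by rewrite lee_fin mulr_ge0 ?tpow_ge0 ?expR_ge0.
rewrite /gamma_int -ge0_integralD//; try exact: measurable_gamma_integrand.
apply: ge0_le_integral => //; try exact: measurable_gamma_integrand.
  by apply: emeasurable_funD; exact: measurable_gamma_integrand.
move=> t _; rewrite -EFinD lee_fin -mulrDl ler_wpM2r ?expR_ge0//.
rewrite /tpow; case: ifPn => t0; last by rewrite addr0.
rewrite subrr powRr0 -natr1 addrK.
have [t1|t1] := leP 1%R t.
  by rewrite (le_trans (ler_powR t1 an))// lerDr.
apply: (@le_trans _ _ 1%R); last by rewrite lerDl powR_ge0.
have /(_ (a - 1)%R) := @ge0_ler_powR R; rewrite subr_ge0 => /(_ a1 t 1%R).
by rewrite powR1; apply; rewrite ?nnegrE// ltW.
Qed.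

Lemma gamma_int_lty a : (0 < a)%R -> gamma_int a < +oo.
Proof.
move=> a0.
have h : gamma_int (a + 1) < +oo by apply: gamma_int_ge1_lty; rewrite lerDr ltW.
have -> : gamma_int a = (a^-1)%:E * gamma_int (a + 1).
  by rewrite gamma_intD1// muleA -EFinM mulVf ?gt_eqF// mul1e.
by rewrite lte_mul_pinfty// lee_fin invr_ge0 ltW.
Qed.

(** For a >= 1 the integrand is at least exp(-t) on [1, +oo[, whose integral is
exp(-1). *)
Lemma gamma_int_ge1_gt0 a : (1 <= a)%R -> 0 < gamma_int a.
Proof.
move=> a1; apply: (@lt_le_trans _ _ (expR (- 1))%:E).
  by rewrite lte_fin expR_gt0.
have mtail : measurable_fun [set: R]
    (fun t => (tpow 1 (t - 1) * expR (- t))%:E).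
  apply/measurable_EFinP/measurable_funM.
    by apply: measurable_tpow_comp; exact: measurable_funB.
  exact: measurableT_comp.
have tail0 t : 0 <= (tpow 1 (t - 1) * expR (- t))%:E.
  by rewrite lee_fin mulr_ge0 ?tpow_ge0 ?expR_ge0.
have <- : \int[mu]_t (tpow 1 (t - 1) * expR (- t))%:E = (expR (- 1))%:E.
  rewrite -(@integral_shift _ _ 1)//.
  rewrite -[RHS]mule1 -gamma_int1 /gamma_int -ge0_integralZl//; first last.
  - by move=> s _; rewrite lee_fin mulr_ge0 ?tpow_ge0 ?expR_ge0.
  - exact: measurable_gamma_integrand.
  apply: eq_integral => t _; rewrite addrK opprD expRD -EFinM.
  by congr EFin; ring.
apply: ge0_le_integral => //; first exact: measurable_gamma_integrand.
move=> t _; rewrite lee_fin ler_wpM2r ?expR_ge0// /tpow subr_ge0 subrr powRr0.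
case: ifPn => t1; last by case: ifP => // _; exact: powR_ge0.
rewrite ifT; last by rewrite (le_trans _ t1).
rewrite -[leLHS](powRr0 t); apply: ler_powR => //.
by rewrite subr_ge0.
Qed.

Lemma gamma_int_gt0 a : (0 < a)%R -> 0 < gamma_int a.
Proof.
move=> a0.
have h : 0 < gamma_int (a + 1) by apply: gamma_int_ge1_gt0; rewrite lerDr ltW.
have -> : gamma_int a = (a^-1)%:E * gamma_int (a + 1).
  by rewrite gamma_intD1// muleA -EFinM mulVf ?gt_eqF// mul1e.
by rewrite mule_gt0// lte_fin invr_gt0.
Qed.

Lemma EFin_Gamma a : (0 < a)%R -> (Gamma a)%:E = gamma_int a.
Proof.
move=> a0; rewrite /Gamma /Rintegral.
suff -> : \int[mu]_(t in `]0%R, +oo[) (t `^ (a - 1) * expR (- t))%:E =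
    gamma_int a.
  by rewrite fineK// ge0_fin_numE ?gamma_int_lty// ltW// gamma_int_gt0.
pose f t := (t `^ (a - 1) * expR (- t))%:E.
have mf : measurable_fun [set: R] f.
  apply/measurable_EFinP/measurable_funM; first exact: measurable_powR.
  exact: measurableT_comp.
rewrite integral_mkcond; apply: (@eq_integral_off_point _ 0%R) => //.
- by apply/(measurable_restrictT f) => //; exact: measurable_funS mf.
- exact: measurable_gamma_integrand.
- move=> t; apply: erestrict_ge0 => s _.
  by rewrite lee_fin mulr_ge0 ?powR_ge0 ?expR_ge0.
- by move=> t; rewrite lee_fin mulr_ge0 ?tpow_ge0 ?expR_ge0.
move=> t t0; rewrite patchE /tpow; case: ifPn.
  by rewrite inE/= in_itv/= andbT => /ltW ->.
rewrite notin_setE/= in_itv/= andbT => /negP; rewrite -leNgt => tle.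
by rewrite ifF ?mul0r// leNgt lt_neqAle t0 tle.
Qed.

Local Open Scope ring_scope.

Lemma Gamma_gt0 a : 0 < a -> 0 < Gamma a.
Proof. by move=> a0; rewrite -lte_fin EFin_Gamma// gamma_int_gt0. Qed.

Lemma GammaDn a (n : nat) : 0 < a -> Gamma (a + n%:R) = poch a n * Gamma a.
Proof.
move=> a0; rewrite /poch; elim: n => [|n ih].
  by rewrite addr0 big_geq ?mul1r.
have an0 : 0 < a + n%:R by rewrite ltr_wpDr.
rewrite big_nat_recr//= mulrAC -ih -natr1 addrA.
have an1 : 0 < a + n%:R + 1 by rewrite addr_gt0.
apply: EFin_inj; rewrite EFin_Gamma// gamma_intD1// -EFin_Gamma//.
by rewrite -EFinM mulrC.
Qed.

Lemma poch_gt0 a (n : nat) : 0 < a -> 0 < poch a n.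
Proof. by move=> a0; apply: prodr_gt0 => i _; rewrite ltr_wpDr. Qed.

End GammaFunction.

(** * The Dirichlet integral over the triangle *)

Section DirichletIntegral.
Local Open Scope classical_set_scope.
Context {R : realType}.
Local Notation mu := (@lebesgue_measure R).
Implicit Types (a b c s t : R).

Lemma beta_int_Gamma a b : 0 < a -> 0 < b ->
  beta_int a b = (Gamma a * Gamma b / Gamma (a + b))%:E.
Proof.
move=> a0 b0; have ab0 : 0 < a + b by exact: addr_gt0.
have := beta_gamma_int a b.
rewrite -!EFin_Gamma// => /(congr1 (fun z => z * (Gamma (a + b))^-1%:E)%E).
rewrite -muleA -!EFinM divff ?mule1// gt_eqF// Gamma_gt0//.
Qed.

(** The integrand of the Dirichlet integral, without normalising factor. *)
Definition dirichlet_density a b c (x : R * R) : R :=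
  x.1 `^ (a - 1) * x.2 `^ (b - 1) * (1 - (x.1 + x.2)) `^ (c - 1).

Lemma measurable_le_set d (T : measurableType d) (f g : T -> R) :
  measurable_fun [set: T] f -> measurable_fun [set: T] g ->
  measurable [set z | f z <= g z].
Proof.
move=> mf mg; rewrite -[X in measurable X]setTI.
exact: (measurable_fun_ler mf mg measurableT (Y := [set true])).
Qed.

Lemma measurable_triangle : measurable (@triangle R).
Proof.
have -> : @triangle R = [set x | 0 <= x.1] `&` [set x | 0 <= x.2] `&`
    [set x | x.1 + x.2 <= 1].
  by apply/seteqP; split => x; rewrite /triangle/=; [case=> ? []|case=> [[]]].
apply: measurableI; first apply: measurableI.
- exact: measurable_le_set.
- exact: measurable_le_set.
- by apply: measurable_le_set => //; exact: measurable_funD.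
Qed.

Local Open Scope ereal_scope.

Lemma dirichlet_integral a b c : (0 < a)%R -> (0 < b)%R -> (0 < c)%R ->
  \int[(mu \x mu)%E]_(x in @triangle R) (dirichlet_density a b c x)%:E =
  (Gamma a * Gamma b * Gamma c / Gamma (a + b + c))%:E.
Proof.
move=> a0 b0 c0.
pose f (x : R * R) : \bar R :=
  (tpow a x.1 * (tpow b x.2 * tpow c (1 - x.1 - x.2)))%:E.
have f0 x : 0 <= f x by rewrite lee_fin !mulr_ge0 ?tpow_ge0.
have mf : measurable_fun [set: R * R] f.
  apply/measurable_EFinP; apply: measurable_funM; last apply: measurable_funM.
  - exact: measurable_tpow_comp.
  - exact: measurable_tpow_comp.
  - apply: measurable_tpow_comp; apply: measurable_funB => //.
    exact: measurable_funB.
rewrite integral_mkcond (_ : _ \_ _ = f); last first.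
  apply/funext => -[x y]; rewrite patchE /f /tpow/=; case: ifPn.
    rewrite inE /triangle/= => -[x0 [y0 xy]].
    by rewrite x0 y0 -addrA -opprD subr_ge0 xy /dirichlet_density/= mulrA.
  rewrite notin_setE /triangle/= => h.
  case: ifPn => x0; last by rewrite mul0r.
  case: ifPn => y0; last by rewrite mul0r mulr0.
  case: ifPn => z0; last by rewrite !mulr0.
  by exfalso; apply: h; split => //; split => //; move: z0; lra.
rewrite fubini_tonelli1// /fubini_F.
transitivity (\int[mu]_x (beta_int b c * (tpow a x * tpow (b + c) (1 - x))%:E)).
  apply: (@eq_integral_off_point _ 1%R).
  - exact: (@measurable_fun_fubini_tonelli_F _ _ _ _ _ mu f).
  - apply: emeasurable_funM => //; apply/measurable_EFinP/measurable_funM.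
      exact: measurable_tpow.
    by apply: measurable_tpow_comp; exact: measurable_funB.
  - by move=> x; apply: integral_ge0.
  - by move=> x; rewrite mule_ge0 ?beta_int_ge0// lee_fin mulr_ge0 ?tpow_ge0.
  move=> x x1; rewrite mulrC EFinM muleA -tpow_convolution; last by lra.
  rewrite muleC -ge0_integralZl//.
  - apply/measurable_EFinP/measurable_funM; first exact: measurable_tpow.
    by apply: measurable_tpow_comp; exact: measurable_funB.
  - by move=> y _; rewrite lee_fin mulr_ge0 ?tpow_ge0.
  - by rewrite lee_fin tpow_ge0.
rewrite ge0_integralZl//; first last.
- exact: beta_int_ge0.
- by move=> x _; rewrite lee_fin mulr_ge0 ?tpow_ge0.
- apply/measurable_EFinP/measurable_funM; first exact: measurable_tpow.
  by apply: measurable_tpow_comp; exact: measurable_funB.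
rewrite -/(beta_int a (b + c)) !beta_int_Gamma ?addr_gt0// -EFinM addrA.
have : Gamma (b + c) != 0%R by rewrite gt_eqF ?Gamma_gt0 ?addr_gt0.
move: (Gamma a) (Gamma b) (Gamma c) (Gamma (b + c)) (Gamma (a + b + c))^-1%R.
by move=> u v w p q p0; congr EFin; field.
Qed.

End DirichletIntegral.

(** * Bounded measurable functions and weighted integrals on the triangle *)

Section BoundedFunctions.
Local Open Scope classical_set_scope.
Context {R : realType}.
Implicit Types (f g : R * R -> R).

(** Measurable and bounded on the triangle; nothing is required outside it. The
product of such a function with the weight is integrable. *)
Definition bounded_measurable f : Prop :=
  measurable_fun (@triangle R) f /\
  exists M, forall x, @triangle R x -> `|f x| <= M.

Lemma bounded_measurable_cst (r : R) : bounded_measurable (fun=> r).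
Proof. by split; [exact: measurable_cst|exists `|r|]. Qed.

Lemma bounded_measurableD f g : bounded_measurable f -> bounded_measurable g ->
  bounded_measurable (fun x => f x + g x).
Proof.
move=> [mf [M fM]] [mg [N gN]]; split; first exact: measurable_funD.
exists (M + N) => x Tx; rewrite (le_trans (ler_normD _ _))//.
by rewrite lerD ?fM ?gN.
Qed.

Lemma bounded_measurableM f g : bounded_measurable f -> bounded_measurable g ->
  bounded_measurable (fun x => f x * g x).
Proof.
move=> [mf [M fM]] [mg [N gN]]; split; first exact: measurable_funM.
by exists (M * N) => x Tx; rewrite normrM ler_pM ?fM ?gN.
Qed.

Lemma bounded_measurableZ (r : R) f : bounded_measurable f ->
  bounded_measurable (fun x => r * f x).
Proof.
move=> bf; apply: bounded_measurableM => //; exact: bounded_measurable_cst.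
Qed.

Lemma bounded_measurableB f g : bounded_measurable f -> bounded_measurable g ->
  bounded_measurable (fun x => f x - g x).
Proof.
move=> bf bg; rewrite (_ : (fun x => _) = (fun x => f x + -1 * g x)).
  by apply: bounded_measurableD => //; exact: bounded_measurableZ.
by apply/funext => x; rewrite mulN1r.
Qed.

Lemma bounded_measurableX (n : nat) f : bounded_measurable f ->
  bounded_measurable (fun x => f x ^+ n).
Proof.
move=> bf; elim: n => [|n ih].
  under [X in bounded_measurable X]eq_fun do rewrite expr0.
  exact: bounded_measurable_cst.
under [X in bounded_measurable X]eq_fun do rewrite exprS.
exact: bounded_measurableM.
Qed.

Lemma bounded_measurable_sum (I : Type) (s : seq I) (F : I -> R * R -> R) :
  (forall i, bounded_measurable (F i)) ->
  bounded_measurable (fun x => \sum_(i <- s) F i x).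
Proof.
move=> bF; elim: s => [|i s ih].
  under [X in bounded_measurable X]eq_fun do rewrite big_nil.
  exact: bounded_measurable_cst.
under [X in bounded_measurable X]eq_fun do rewrite big_cons.
exact: bounded_measurableD.
Qed.

Lemma bounded_measurable_coord1 : bounded_measurable (fun x => x.1).
Proof.
split.
  by apply: (@measurable_funS _ _ _ _ setT) => //; exact: measurable_fst.
by exists 1 => x [x0 [y0 xy]]; rewrite ger0_norm//; lra.
Qed.

Lemma bounded_measurable_coord2 : bounded_measurable (fun x => x.2).
Proof.
split.
  by apply: (@measurable_funS _ _ _ _ setT) => //; exact: measurable_snd.
by exists 1 => x [x0 [y0 xy]]; rewrite ger0_norm//; lra.
Qed.

Lemma bounded_measurable_coord3 :
  bounded_measurable (fun x => 1 - (x.1 + x.2)).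
Proof.
apply: bounded_measurableB; first exact: bounded_measurable_cst.
by apply: bounded_measurableD;
  [exact: bounded_measurable_coord1|exact: bounded_measurable_coord2].
Qed.

Lemma bounded_measurableV f (r : R) : bounded_measurable f -> 0 < r ->
  (forall x, @triangle R x -> r <= f x) ->
  bounded_measurable (fun x => (f x)^-1).
Proof.
move=> [mf _] r0 rf; split.
  (* [powR] with exponent -1 is a measurable function that agrees with the
     inverse at nonnegative arguments. *)
  apply: (@eq_measurable_fun _ _ _ _ _ (fun x => f x `^ (-1))).
    by move=> x /set_mem Tx; rewrite powR_inv1// ltW// (lt_le_trans r0)// rf.
  exact: (measurableT_comp (@measurable_powR R (-1)) mf).
exists r^-1 => x Tx; have fx := rf _ Tx; have f0 := lt_le_trans r0 fx.
by rewrite ger0_norm ?invr_ge0 ?(ltW f0)// lef_pV2.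
Qed.

End BoundedFunctions.

Section DirichletDensity.
Local Open Scope classical_set_scope.
Context {R : realType}.
Local Notation mu := (@lebesgue_measure R).

Lemma dirichlet_density_ge0 a b c (x : R * R) : 0 <= dirichlet_density a b c x.
Proof. by rewrite /dirichlet_density !mulr_ge0 ?powR_ge0. Qed.

Lemma measurable_dirichlet_density a b c :
  measurable_fun (@triangle R) (dirichlet_density a b c).
Proof.
apply: measurable_funTS; apply: measurable_funM; first apply: measurable_funM.
- exact: (measurableT_comp (@measurable_powR R _)).
- exact: (measurableT_comp (@measurable_powR R _)).
- apply: (measurableT_comp (@measurable_powR R _)).
  by apply: measurable_funB => //; exact: measurable_funD.
Qed.


Lemma integrable_dirichlet_density (a b c : R) : 0 < a -> 0 < b -> 0 < c ->
  (mu \x mu)%E.-integrable (@triangle R) (EFin \o dirichlet_density a b c).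
Proof.
move=> a0 b0 c0; apply/integrableP; split.
  by apply/measurable_EFinP; exact: measurable_dirichlet_density.
under eq_integral => x _ do
  rewrite /= (ger0_norm (dirichlet_density_ge0 a b c x)).
by rewrite dirichlet_integral// ltry.
Qed.

Lemma integral_T_dirichlet (r a b c : R) : 0 < a -> 0 < b -> 0 < c ->
  integral_T (fun x => r * dirichlet_density a b c x) =
  r * (Gamma a * Gamma b * Gamma c / Gamma (a + b + c)).
Proof.
move=> a0 b0 c0; rewrite /integral_T RintegralZl.
- by rewrite /Rintegral dirichlet_integral.
- exact: measurable_triangle.
- exact: integrable_dirichlet_density.
Qed.

End DirichletDensity.

Section WeightedIntegral.
Local Open Scope classical_set_scope.
Context {R : realType}.
Local Notation mu := (@lebesgue_measure R).
Variable alpha : 'I_3 -> R.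
Hypothesis alpha_gt : forall i, -1 < alpha i.
Implicit Types (f g : R * R -> R).

Let a1_gt0 i : 0 < alpha i + 1.
Proof. by rewrite -ltrBlDr sub0r. Qed.

Lemma sum_alphaD3 :
  \sum_(i < 3) alpha i + 3 = (alpha 0 + 1) + (alpha 1 + 1) + (alpha 2 + 1).
Proof.
rewrite !big_ord_recl big_ord0.
rewrite (_ : lift ord0 ord0 = 1)//; last exact/val_inj.
rewrite (_ : lift ord0 (lift ord0 ord0) = 2)//; last exact/val_inj.
have -> : (ord0 : 'I_3) = 0 by [].
by ring.
Qed.

Lemma Acoef_gt0 : 0 < Acoef alpha.
Proof.
rewrite /Acoef divr_gt0//; last by apply: prodr_gt0 => i _; exact: Gamma_gt0.
apply: Gamma_gt0; rewrite sum_alphaD3.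
by apply: addr_gt0; first apply: addr_gt0; exact: a1_gt0.
Qed.

Lemma weightE x : weight alpha x = Acoef alpha *
  dirichlet_density (alpha 0 + 1) (alpha 1 + 1) (alpha 2 + 1) x.
Proof. by rewrite /weight /dirichlet_density !addrK !mulrA. Qed.

Lemma weight_ge0 x : 0 <= weight alpha x.
Proof.
rewrite weightE; apply: mulr_ge0; first exact/ltW/Acoef_gt0.
exact: dirichlet_density_ge0.
Qed.

Lemma measurable_weight : measurable_fun (@triangle R) (weight alpha).
Proof.
apply: (@eq_measurable_fun _ _ _ _ _ (fun x => Acoef alpha *
  dirichlet_density (alpha 0 + 1) (alpha 1 + 1) (alpha 2 + 1) x)).
  by move=> x _; rewrite weightE.
by apply: measurable_funM => //; exact: measurable_dirichlet_density.
Qed.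

Lemma integrable_weight :
  (mu \x mu)%E.-integrable (@triangle R) (EFin \o weight alpha).
Proof.
pose d := dirichlet_density (alpha 0 + 1) (alpha 1 + 1) (alpha 2 + 1).
rewrite (_ : EFin \o _ = (fun x => (Acoef alpha)%:E * (EFin \o d) x)%E).
  apply: integrableZl; first exact: measurable_triangle.
  exact: integrable_dirichlet_density.
by apply/funext => x /=; rewrite weightE.
Qed.

Lemma integrable_weightM f : bounded_measurable f ->
  (mu \x mu)%E.-integrable (@triangle R)
    (EFin \o (fun x => weight alpha x * f x)).
Proof.
move=> [mf [M fM]].
have wM : (mu \x mu)%E.-integrable (@triangle R)
    (EFin \o (fun x => M * weight alpha x)).
  rewrite (_ : EFin \o _ = (fun x => M%:E * (EFin \o weight alpha) x)%E)//.
  by apply: integrableZl; [exact: measurable_triangle|exact: integrable_weight].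
apply: (@le_integrable _ _ _ _ _ _ _ _ _ _ wM).
- exact: measurable_triangle.
- by apply/measurable_EFinP/measurable_funM => //; exact: measurable_weight.
move=> x Tx /=; rewrite lee_fin !normrM [leLHS]mulrC ler_wpM2r//.
by rewrite (le_trans (fM _ Tx))// ler_norm.
Qed.

(** Integration against the weight; the inner product of f and g is the
weighted integral of their product. *)
Definition weighted_integral f : R :=
  integral_T (fun x => weight alpha x * f x).

Lemma innerE f g : inner alpha f g = weighted_integral (fun x => f x * g x).
Proof.
by rewrite /inner; congr integral_T; apply/funext => x; rewrite mulrA.
Qed.

Lemma weighted_integralD f g : bounded_measurable f -> bounded_measurable g ->
  weighted_integral (fun x => f x + g x) =
  weighted_integral f + weighted_integral g.
Proof.
move=> bf bg; rewrite /weighted_integral /integral_T -RintegralD//.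
- by congr Rintegral; apply/funext => x; rewrite mulrDr.
- exact: measurable_triangle.
- exact: integrable_weightM.
- exact: integrable_weightM.
Qed.

Lemma weighted_integralZ (r : R) f : bounded_measurable f ->
  weighted_integral (fun x => r * f x) = r * weighted_integral f.
Proof.
move=> bf; rewrite /weighted_integral /integral_T -RintegralZl//.
- by congr Rintegral; apply/funext => x; rewrite mulrCA.
- exact: measurable_triangle.
- exact: integrable_weightM.
Qed.

Lemma weighted_integral_sum (I : Type) (s : seq I) (a : I -> R)
    (F : I -> R * R -> R) :
  (forall i, bounded_measurable (F i)) ->
  weighted_integral (fun x => \sum_(i <- s) a i * F i x) =
  \sum_(i <- s) a i * weighted_integral (F i).
Proof.
move=> bF; elim: s => [|i s ih].
  under [X in weighted_integral X]eq_fun do rewrite big_nil -(mul0r 0).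
  by rewrite big_nil weighted_integralZ ?mul0r//; exact: bounded_measurable_cst.
under [X in weighted_integral X]eq_fun do rewrite big_cons.
rewrite big_cons weighted_integralD ?weighted_integralZ ?ih//.
- exact: bounded_measurableZ.
- by apply: bounded_measurable_sum => j; exact: bounded_measurableZ.
Qed.

Lemma weighted_integral_ge0 f : (forall x, @triangle R x -> 0 <= f x) ->
  0 <= weighted_integral f.
Proof.
by move=> f0; apply: Rintegral_ge0 => x Tx; rewrite mulr_ge0 ?weight_ge0 ?f0.
Qed.

End WeightedIntegral.

(** * Bernstein polynomials *)

Section BernsteinPolynomials.
Context {R : realType}.
Implicit Types (x : R * R) (h k l : nat * nat).

Lemma mem_Theta (N : nat) k : (k \in Theta N) = (norm1 k <= N)%N.
Proof.
have : (norm1 k <= N)%N ->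
    k \in [seq (i, j) | i <- iota 0 N.+1, j <- iota 0 N.+1].
  case: k => i j; rewrite /norm1 [(_, _).1]/= [(_, _).2]/= => kN.
  by apply: allpairs_f; rewrite mem_iota; lia.
rewrite /Theta; move: [seq _ | _ <- _, _ <- _] => s ks.
by rewrite !inE/= andb_idl.
Qed.

Lemma Omega_Theta c (N : nat) k : k \in Omega c N -> k \in Theta N.
Proof. by rewrite !inE => /andP[]. Qed.

Lemma mem_Gam c (N : nat) k :
  (k \in Gam c N) = (k \notin Omega c N) && (k \in Theta N).
Proof. by rewrite in_fsetD. Qed.

Lemma eval2_sum (I : Type) (s : seq I) (F : I -> mpoly 2 R) x :
  eval2 (\sum_(i <- s) F i) x = \sum_(i <- s) eval2 (F i) x.
Proof. by rewrite /eval2 raddf_sum. Qed.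

Lemma eval2Z (r : R) (P : mpoly 2 R) x : eval2 (r *: P) x = r * eval2 P x.
Proof. by rewrite /eval2 mevalZ. Qed.

Lemma eval2_bern (N : nat) k x : eval2 (bern R N k) x =
  tbinom R N k * (x.1 ^+ k.1 * x.2 ^+ k.2 * (1 - (x.1 + x.2)) ^+ (N - norm1 k)).
Proof.
rewrite /bern eval2Z /eval2 !rmorphM/= !rmorphXn/= /X3 mevalB mevalD meval1.
by rewrite /X1 /X2 !mevalXU.
Qed.

Lemma eval2_bezier (N : nat) (p : nat * nat -> R) x :
  eval2 (bezier N p) x = \sum_(k <- Theta N) p k * eval2 (bern R N k) x.
Proof. by rewrite /bezier eval2_sum; under eq_bigr do rewrite eval2Z. Qed.

Lemma tbinom_gt0 (N : nat) k : 0 < tbinom R N k.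
Proof. by rewrite divr_gt0// ltr0n ?muln_gt0 ?fact_gt0. Qed.

Lemma bounded_measurable_bern (N : nat) k :
  bounded_measurable (eval2 (bern R N k)).
Proof.
rewrite (_ : eval2 _ = (fun x => tbinom R N k *
    (x.1 ^+ k.1 * x.2 ^+ k.2 * (1 - (x.1 + x.2)) ^+ (N - norm1 k)))).
  apply: bounded_measurableZ; apply: bounded_measurableM;
    first apply: bounded_measurableM.
  - exact/bounded_measurableX/bounded_measurable_coord1.
  - exact/bounded_measurableX/bounded_measurable_coord2.
  - exact/bounded_measurableX/bounded_measurable_coord3.
by apply/funext => x; rewrite eval2_bern.
Qed.

Lemma bern_ge0 (N : nat) k x : @triangle R x -> 0 <= eval2 (bern R N k) x.
Proof.
move=> [x0 [y0 xy]]; rewrite eval2_bern mulr_ge0 ?(ltW (tbinom_gt0 _ _))//.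
by rewrite !mulr_ge0// exprn_ge0// subr_ge0.
Qed.

Lemma eval2_bezier_eq (N : nat) (p : nat * nat -> R) :
  eval2 (bezier N p) =
  (fun x => \sum_(k <- Theta N) p k * eval2 (bern R N k) x).
Proof. by apply/funext => x; rewrite eval2_bezier. Qed.

Lemma bounded_measurable_bezier (N : nat) (p : nat * nat -> R) :
  bounded_measurable (eval2 (bezier N p)).
Proof.
rewrite eval2_bezier_eq; apply: bounded_measurable_sum => k.
by apply: bounded_measurableZ; exact: bounded_measurable_bern.
Qed.

Lemma bezier_ge_term (N : nat) (p : nat * nat -> R) k x :
  (forall j, j \in Theta N -> 0 < p j) -> k \in Theta N -> @triangle R x ->
  p k * eval2 (bern R N k) x <= eval2 (bezier N p) x.
Proof.
move=> p0 kN Tx; rewrite eval2_bezier (bigD1_seq k)//= ?fset_uniq// lerDl.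
rewrite big_seq_cond sumr_ge0// => j /andP[jN _].
by rewrite mulr_ge0 ?bern_ge0// ltW// p0.
Qed.

(** At every point of the triangle one of the three barycentric coordinates is
at least 1/3, and the Bernstein polynomial at the corresponding vertex is then
at least 3^-N. *)
Lemma bezier_lower_bound (N : nat) (p : nat * nat -> R) :
  (forall k, k \in Theta N -> 0 < p k) ->
  exists2 r : R, 0 < r & forall x, @triangle R x -> r <= eval2 (bezier N p) x.
Proof.
move=> p0.
have k1 : (N, 0)%N \in Theta N by rewrite mem_Theta /norm1/= addn0.
have k2 : (0, N)%N \in Theta N by rewrite mem_Theta /norm1/=.
have k3 : (0, 0)%N \in Theta N by rewrite mem_Theta.
pose q k := p k * (tbinom R N k * 3^-1 ^+ N).
have q0 k : k \in Theta N -> 0 < q k.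
  by move=> kN; rewrite !mulr_gt0 ?p0 ?tbinom_gt0// exprn_gt0// invr_gt0.
exists (Num.min (q (N, 0)%N) (Num.min (q (0, N)%N) (q (0, 0)%N))).
  by rewrite !lt_min !q0.
move=> x Tx; have [x0 [y0 xy]] := Tx.
have third y : 3^-1 <= y -> (3^-1 : R) ^+ N <= y ^+ N.
  by move=> ty; rewrite lerXn2r ?nnegrE ?invr_ge0 ?(le_trans _ ty)// invr_ge0.
have key k : k \in Theta N ->
    3^-1 ^+ N <= x.1 ^+ k.1 * x.2 ^+ k.2 * (1 - (x.1 + x.2)) ^+ (N - norm1 k) ->
    q k <= eval2 (bezier N p) x.
  move=> kN h; apply: le_trans (bezier_ge_term p0 kN Tx).
  rewrite eval2_bern /q ler_wpM2l ?(ltW (p0 _ kN))//.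
  by rewrite ler_wpM2l ?(ltW (tbinom_gt0 _ _)).
have [h|h1] := leP 3^-1 x.1.
  rewrite ge_min key//= /norm1/= addn0 subnn !expr0 !mulr1.
  exact: third.
have [h|h2] := leP 3^-1 x.2.
  rewrite !ge_min (key (0, N)%N) ?orbT//= /norm1/= add0n subnn.
  by rewrite !expr0 mulr1 mul1r; exact: third.
rewrite !ge_min (key (0, 0)%N) ?orbT//= /norm1/= addn0 subn0.
by rewrite !expr0 !mul1r; apply: third; lra.
Qed.

Lemma bounded_measurable_inv_bezier (N : nat) (p : nat * nat -> R) :
  (forall k, k \in Theta N -> 0 < p k) ->
  bounded_measurable (fun x => (eval2 (bezier N p) x)^-1).
Proof.
move=> p0; have [r r0 h] := bezier_lower_bound p0.
exact: (bounded_measurableV (bounded_measurable_bezier N p) r0).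
Qed.

Lemma bernM (n m : nat) h l x : h \in Theta n -> l \in Theta m ->
  eval2 (bern R n h) x * eval2 (bern R m l) x =
  tbinom R n h * tbinom R m l * (tbinom R (n + m) (addk h l))^-1 *
  eval2 (bern R (n + m) (addk h l)) x.
Proof.
rewrite !mem_Theta => hn lm; rewrite !eval2_bern [RHS]mulrA divfK; last first.
  by rewrite gt_eqF ?tbinom_gt0.
have -> : (n + m - norm1 (addk h l) = (n - norm1 h) + (m - norm1 l))%N.
  by move: hn lm; rewrite /norm1 /addk/=; lia.
by rewrite /addk/= !exprD; ring.
Qed.

(** The identity also holds at y = 0, since a + n is nonzero when n > 0. *)
Lemma powR_exprM (a y : R) (n : nat) : -1 < a -> 0 <= y ->
  y `^ a * y ^+ n = y `^ (a + n%:R).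
Proof.
move=> a1 y0; case: n => [|n]; first by rewrite addr0 mulr1.
have an0 : a + n.+1%:R != 0 by rewrite gt_eqF// -natr1; have := ler0n R n; lra.
have [->|yn0] := eqVneq y 0; first by rewrite [RHS]powR0// exprS mul0r mulr0.
by rewrite powRD ?yn0 ?implybT// powR_mulrn.
Qed.

End BernsteinPolynomials.

(** * Left inverses of symmetric matrices and normal equations *)

Section GramInverse.
Context {R : comPzRingType} {K : choiceType}.
Variables (S : {fset K}) (G E : K -> K -> R).
Hypothesis GC : forall k l, k \in S -> l \in S -> G k l = G l k.
Hypothesis EG : forall k l, k \in S -> l \in S ->
  \sum_(j <- S) E k j * G j l = (k == l)%:R.

Lemma sum_fset_delta (k : K) (F : K -> R) : k \in S ->
  \sum_(j <- S) (k == j)%:R * F j = F k.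
Proof.
move=> kS; rewrite (bigD1_seq k)//= eqxx mul1r big1 ?addr0// => j jk.
by rewrite eq_sym (negbTE jk) mul0r.
Qed.

(** Both sides are evaluations of the entry (k, l) of E G E^T. *)
Lemma left_inverse_symmetric k l : k \in S -> l \in S -> E k l = E l k.
Proof.
move=> kS lS; transitivity (\sum_(j <- S) E k j * \sum_(i <- S) E l i * G i j).
  rewrite -(sum_fset_delta (E k) lS); apply: eq_big_seq => j jS.
  by rewrite EG// mulrC.
under eq_bigr do rewrite mulr_sumr; rewrite exchange_big/=.
rewrite -(sum_fset_delta (E l) kS); apply: eq_big_seq => i iS.
rewrite -EG// mulr_suml; apply: eq_big_seq => j jS.
by rewrite (GC jS iS) mulrCA mulrC.
Qed.

Lemma normal_equations_solution (p b : K -> R) :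
  (forall l, l \in S -> \sum_(k <- S) p k * G k l = b l) <->
  (forall k, k \in S -> p k = \sum_(l <- S) b l * E k l).
Proof.
split=> h k kS.
- rewrite -(sum_fset_delta p kS).
  transitivity (\sum_(j <- S) (\sum_(l <- S) E k l * G l j) * p j).
    by apply: eq_big_seq => j jS; rewrite EG.
  under eq_bigr do rewrite mulr_suml; rewrite exchange_big/=.
  apply: eq_big_seq => l lS; rewrite -(h _ lS) mulr_suml.
  by apply: eq_big_seq => j jS; rewrite (GC lS jS); ring.
- transitivity (\sum_(j <- S) (\sum_(l <- S) b l * E j l) * G j k).
    by apply: eq_big_seq => j jS; rewrite h.
  under eq_bigr do rewrite mulr_suml; rewrite exchange_big/=.
  rewrite -(sum_fset_delta b kS); apply: eq_big_seq => l lS.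
  rewrite eq_sym -EG// mulr_suml; apply: eq_big_seq => j jS.
  by rewrite (left_inverse_symmetric jS lS); ring.
Qed.

End GramInverse.

(** * The inner product and the Gram matrix of the Bernstein basis *)

Section InnerProduct.
Context {R : realType}.
Variable alpha : 'I_3 -> R.
Hypothesis alpha_gt : forall i, -1 < alpha i.
Implicit Types (f g : R * R -> R).

Lemma innerC f g : inner alpha f g = inner alpha g f.
Proof.
by rewrite !innerE; congr weighted_integral; apply/funext => x; rewrite mulrC.
Qed.

Lemma inner_ge0 f : 0 <= inner alpha f f.
Proof.
by rewrite innerE; apply: weighted_integral_ge0 => // x _; exact: sqr_ge0.
Qed.

Lemma inner_suml (I : Type) (s : seq I) (a : I -> R) (F : I -> R * R -> R) g :
  (forall i, bounded_measurable (F i)) -> bounded_measurable g ->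
  inner alpha (fun x => \sum_(i <- s) a i * F i x) g =
  \sum_(i <- s) a i * inner alpha (F i) g.
Proof.
move=> bF bg; rewrite innerE; under eq_bigr do rewrite innerE.
rewrite -weighted_integral_sum//; last by move=> i; exact: bounded_measurableM.
congr weighted_integral; apply/funext => x; rewrite mulr_suml.
by apply: eq_bigr => i _; rewrite mulrA.
Qed.

Lemma innerBl f1 f2 g : bounded_measurable f1 -> bounded_measurable f2 ->
  bounded_measurable g ->
  inner alpha (fun x => f1 x - f2 x) g = inner alpha f1 g - inner alpha f2 g.
Proof.
move=> b1 b2 bg; rewrite !innerE -mulN1r -weighted_integralZ//; last first.
  exact: bounded_measurableM.
rewrite -weighted_integralD//; last first.
- by apply: bounded_measurableZ; exact: bounded_measurableM.
- exact: bounded_measurableM.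
by congr weighted_integral; apply/funext => x; ring.
Qed.

Lemma innerZr (r : R) f g : bounded_measurable f -> bounded_measurable g ->
  inner alpha f (fun x => r * g x) = r * inner alpha f g.
Proof.
move=> bf bg; rewrite !innerE -weighted_integralZ//; last first.
  exact: bounded_measurableM.
by congr weighted_integral; apply/funext => x; ring.
Qed.

Lemma inner_sqrB f g : bounded_measurable f -> bounded_measurable g ->
  inner alpha (fun x => f x - g x) (fun x => f x - g x) =
  inner alpha f f - 2 * inner alpha f g + inner alpha g g.
Proof.
move=> bf bg; have bfg := bounded_measurableB bf bg.
rewrite innerBl// [inner alpha f _]innerC [inner alpha g _]innerC !innerBl//.
by rewrite (innerC g f); ring.
Qed.

Let a1_gt0 i : 0 < alpha i + 1.
Proof. by rewrite -ltrBlDr sub0r. Qed.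

Lemma prod_ord3 (F : 'I_3 -> R) : \prod_(i < 3) F i = F 0 * F 1 * F 2.
Proof.
rewrite !big_ord_recl big_ord0.
rewrite (_ : lift ord0 ord0 = 1)//; last exact/val_inj.
rewrite (_ : lift ord0 (lift ord0 ord0) = 2)//; last exact/val_inj.
by rewrite mulr1 mulrA.
Qed.

(** The product of the weight with two Bernstein polynomials is a multiple of a
Dirichlet density with parameters alpha_i + 1 + h_i + l_i. *)
Lemma inner_bern (m : nat) (h l : nat * nat) : h \in Theta m -> l \in Theta m ->
  inner alpha (eval2 (bern R m h)) (eval2 (bern R m l)) =
  tbinom R m h * tbinom R m l * ((poch (\sum_(i < 3) alpha i + 3) (2 * m))^-1 *
  \prod_(i < 3) poch (alpha i + 1) (ext m h i + ext m l i)%N).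
Proof.
rewrite !mem_Theta => hm lm.
pose e i := (ext m h i + ext m l i)%N.
pose a i := alpha i + 1 + (e i)%:R.
have a0 i : 0 < a i by rewrite ltr_wpDr.
transitivity (integral_T (fun x => (Acoef alpha * tbinom R m h * tbinom R m l) *
    dirichlet_density (a 0) (a 1) (a 2) x)).
  apply: eq_Rintegral => x /set_mem[x0 [y0 xy]].
  have z0 : 0 <= 1 - (x.1 + x.2) by rewrite subr_ge0.
  rewrite /weight !eval2_bern /dirichlet_density /a /e.
  have exps i : a i - 1 = alpha i + (e i)%:R by rewrite /a; ring.
  rewrite !{}exps -!powR_exprM// /e /ext/= !exprD; ring.
rewrite integral_T_dirichlet//.
have sumE : a 0 + a 1 + a 2 = \sum_(i < 3) alpha i + 3 + (2 * m)%:R.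
  rewrite sum_alphaD3 /a /e /ext/=.
  have -> : (2 * m = (h.1 + l.1) + (h.2 + l.2) +
      ((m - norm1 h) + (m - norm1 l)))%N.
    by move: hm lm; rewrite /norm1; lia.
  by rewrite !natrD; ring.
have s0 : 0 < \sum_(i < 3) alpha i + 3.
  by rewrite sum_alphaD3; apply: addr_gt0; first apply: addr_gt0.
have GammaE i : Gamma (a i) = poch (alpha i + 1) (e i) * Gamma (alpha i + 1).
  exact: GammaDn.
rewrite sumE /Acoef (GammaDn (2 * m) s0) !GammaE !prod_ord3.
have gs0 := gt_eqF (Gamma_gt0 s0); have ps0 := gt_eqF (poch_gt0 (2 * m) s0).
have g0 i := gt_eqF (Gamma_gt0 (a1_gt0 i)).
move: (g0 0) (g0 1) (g0 2); rewrite -/(e 0) -/(e 1) -/(e 2); move: gs0 ps0.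
move: (Gamma (alpha 0 + 1)) (Gamma (alpha 1 + 1)) (Gamma (alpha 2 + 1)).
move: (Gamma (_ + 3)) (poch (_ + 3) _).
move: (poch _ (e 0)) (poch _ (e 1)) (poch _ (e 2)).
move: (tbinom R m h) (tbinom R m l).
move=> th tl p0 p1 p2 gs ps ga gb gc gsn psn gan gbn gcn.
by field; rewrite ?gsn ?psn ?gan ?gbn ?gcn.
Qed.

End InnerProduct.

(** * Constrained least squares approximation *)

Section ConstrainedLeastSquares.
Context {R : realType}.
Variables (n m : nat) (alpha : 'I_3 -> R) (c : 'I_3 -> nat).
Variables (omega r : nat * nat -> R).
Hypothesis alpha_gt : forall i, -1 < alpha i.
Hypothesis omega_gt0 : forall k, k \in Theta n -> 0 < omega k.
Implicit Types (p q g : nat * nat -> R) (k l h : nat * nat).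

Local Notation B k := (eval2 (bern R m k)).
Local Notation Rf := (rational_bezier n omega r).
Local Notation P p := (eval2 (bezier m p)).

Lemma bounded_measurable_rational_bezier : bounded_measurable Rf.
Proof.
apply: bounded_measurableM; first exact: bounded_measurable_bezier.
exact: bounded_measurable_inv_bezier.
Qed.

Lemma bounded_measurable_error p : bounded_measurable (fun x => Rf x - P p x).
Proof.
apply: bounded_measurableB; first exact: bounded_measurable_rational_bezier.
exact: bounded_measurable_bezier.
Qed.

Lemma sum_Theta (F : nat * nat -> R) :
  \sum_(k <- Theta m) F k = \sum_(k <- Omega c m) F k + \sum_(k <- Gam c m) F k.
Proof.
rewrite -big_cat/=; apply/perm_big/uniq_perm.
- exact: fset_uniq.
- rewrite cat_uniq !fset_uniq/= andbT; apply/hasPn => k.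
  by rewrite mem_Gam => /andP[].
- move=> k; rewrite mem_cat mem_Gam; case: (boolP (k \in Omega c m)) => //= kO.
  by rewrite (Omega_Theta kO).
Qed.

Lemma inner_rational_bezier_bern l : l \in Theta m ->
  inner alpha Rf (B l) = tbinom R m l * u_coef alpha n m omega r l.
Proof.
move=> lm; rewrite innerE.
pose F h x := eval2 (bern R (n + m) (addk h l)) x / eval2 (bezier n omega) x.
have bF h : bounded_measurable (F h).
  apply: bounded_measurableM; first exact: bounded_measurable_bern.
  exact: bounded_measurable_inv_bezier.
pose a h := tbinom R m l * (tbinom R n h * (tbinom R (n + m) (addk h l))^-1 *
  omega h * r h).
transitivity (weighted_integral alpha
    (fun x => \sum_(h <- Theta n) a h * F h x)).
  congr weighted_integral; apply/funext => x.
  rewrite /rational_bezier eval2_bezier !mulr_suml; apply: eq_big_seq => h hn.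
  have := bernM x hn lm; rewrite /a /F.
  move: (eval2 (bern R n h) x) (B l x) (eval2 (bern R (n + m) _) x).
  move: (eval2 _ x)^-1.
  move=> d b1 b2 b3 e.
  rewrite (_ : _ * _ * d * b2 = omega h * r h * d * (b1 * b2)); last by ring.
  by rewrite e; ring.
rewrite weighted_integral_sum// /u_coef mulr_sumr; apply: eq_bigr => h _.
by rewrite /a -!mulrA.
Qed.

Lemma inner_fixed_part_bern g l : l \in Theta m ->
  \sum_(h <- Gam c m) g h * inner alpha (B h) (B l) =
  tbinom R m l * v_coef alpha c m g l.
Proof.
move=> lm; rewrite /v_coef mulrCA mulr_sumr mulr_sumr; apply: eq_big_seq => h.
rewrite mem_Gam => /andP[_ hm]; rewrite inner_bern//.
set d := _^-1; set pr := \prod_(i < 3) _; rewrite -/pr; ring.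
Qed.

(** The residual of a feasible p is orthogonal to B_l exactly when the normal
equation of index l holds. *)
Lemma residual_bern p g l : satisfies_constraints c m g p -> l \in Theta m ->
  inner alpha (fun x => Rf x - P p x) (B l) =
  tbinom R m l * (u_coef alpha n m omega r l - v_coef alpha c m g l) -
  \sum_(k <- Omega c m) p k * inner alpha (B k) (B l).
Proof.
move=> pg lm; rewrite innerBl//; first last.
- exact: bounded_measurable_bern.
- exact: bounded_measurable_bezier.
- exact: bounded_measurable_rational_bezier.
rewrite inner_rational_bezier_bern// eval2_bezier_eq inner_suml//; first last.
- exact: bounded_measurable_bern.
- by move=> k; exact: bounded_measurable_bern.
rewrite sum_Theta mulrBr -(inner_fixed_part_bern g)//.
rewrite [X in _ - (_ + X)](eq_big_seq (fun h => g h * inner alpha (B h) (B l))).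
  by ring.
by move=> h hG; rewrite pg.
Qed.

(** Expansion of the error around p; p and q share their fixed coefficients, so
only the free ones enter the linear term. *)
Lemma sq_error_perturbation p q : (forall k, k \in Gam c m -> q k = p k) ->
  sq_error alpha n m omega r q = sq_error alpha n m omega r p -
  2 * (\sum_(k <- Omega c m) (q k - p k) *
         inner alpha (fun x => Rf x - P p x) (B k)) +
  inner alpha (P (fun k => q k - p k)) (P (fun k => q k - p k)).
Proof.
move=> qp; rewrite /sq_error/=.
rewrite (_ : (fun x => Rf x - P q x) =
    (fun x => (Rf x - P p x) - P (fun k => q k - p k) x)); last first.
  apply/funext => x; rewrite !eval2_bezier -addrA -opprD -big_split/=.
  by congr (_ - _); apply: eq_bigr => k _; ring.
rewrite inner_sqrB//; first last.
- exact: bounded_measurable_bezier.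
- exact: bounded_measurable_error.
congr (_ - 2 * _ + _); rewrite innerC eval2_bezier_eq inner_suml//; first last.
- exact: bounded_measurable_error.
- by move=> k; exact: bounded_measurable_bern.
rewrite sum_Theta [X in _ + X]big1_seq ?addr0.
  by apply: eq_bigr => k _; rewrite innerC.
by move=> k /= kG; rewrite qp// subrr mul0r.
Qed.

(** The minimisers are the feasible points whose residual is orthogonal to the
Bernstein polynomials with free coefficients. *)
Lemma constrained_minimiserP g p :
  constrained_minimiser alpha c n m omega r g p <->
  satisfies_constraints c m g p /\
  forall l, l \in Omega c m -> inner alpha (fun x => Rf x - P p x) (B l) = 0.
Proof.
split=> -[pg h]; split=> //.
- move=> l lO; set o := inner _ _ _.
  pose G := inner alpha (B l) (B l).
  have G0 : 0 <= G by exact: inner_ge0.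
  (* Any small enough multiple of o is a step along B_l that lowers the error
     unless o = 0; G + 1 avoids assuming that G is nonzero. *)
  pose t := o / (G + 1).
  pose q k := p k + t * (l == k)%:R.
  have qp k : k \in Gam c m -> q k = p k.
    rewrite mem_Gam => /andP[kO _]; rewrite /q.
    case: eqP => [lk|]; last by rewrite mulr0 addr0.
    by move: kO; rewrite -lk lO.
  have qg : satisfies_constraints c m g q by move=> k kG; rewrite qp// pg.
  have dE : P (fun k => q k - p k) = (fun x => t * B l x).
    apply/funext => x; rewrite eval2_bezier.
    rewrite -(sum_fset_delta (fun k => t * B k x) (Omega_Theta lO)).
    by apply: eq_bigr => k _; rewrite /q; ring.
  have := h _ qg; rewrite (sq_error_perturbation qp) dE.
  have bl := bounded_measurable_bern m l.
  rewrite innerZr//; last exact: bounded_measurableZ.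
  rewrite [inner _ (fun x => _) (B l)]innerC innerZr// -/G.
  have -> : \sum_(k <- Omega c m) (q k - p k) *
      inner alpha (fun x => Rf x - P p x) (B k) = t * o.
    rewrite -(sum_fset_delta
      (fun k => t * inner alpha (fun x => Rf x - P p x) (B k)) lO).
    by apply: eq_bigr => k _; rewrite /q; ring.
  have G1 : G + 1 != 0 by rewrite gt_eqF// ltr_wpDl.
  have oE : o = t * (G + 1) by rewrite /t divfK.
  rewrite -subr_ge0 => le0.
  have : (G + 2) * t ^+ 2 <= 0 by move: le0; rewrite oE; nra.
  rewrite pmulr_rle0; last by rewrite ltr_wpDl.
  move=> t2; have /eqP : t ^+ 2 == 0 by rewrite eq_le t2 sqr_ge0.
  by move/eqP; rewrite sqrf_eq0 => /eqP t0; rewrite oE t0 mul0r.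
- move=> q qg; rewrite (@sq_error_perturbation p q); last first.
    by move=> k kG; rewrite qg// pg.
  rewrite big1_seq ?mulr0 ?subr0 ?lerDl ?inner_ge0// => k /= kO.
  by rewrite h// mulr0.
Qed.

End ConstrainedLeastSquares.

(** Duality expressed on coefficients: the Bezier coefficients of the dual
polynomials form a left inverse of the Gram matrix. *)
Lemma bezier_coefs_left_inverse (R : realType) (m : nat) (alpha : 'I_3 -> R)
    (c : 'I_3 -> nat) (D : nat * nat -> mpoly 2 R)
    (E : nat * nat -> nat * nat -> R) :
  (forall i, -1 < alpha i) ->
  dual_bernstein alpha c m D -> bezier_coefs c m D E ->
  forall k l, k \in Omega c m -> l \in Omega c m ->
  \sum_(j <- Omega c m) E k j *
    inner alpha (eval2 (bern R m j)) (eval2 (bern R m l)) = (k == l)%:R.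
Proof.
move=> alpha_gt [_ dual] coefs k l kO lO; rewrite -dual// coefs//.
rewrite -inner_suml//; first last.
- exact: bounded_measurable_bern.
- by move=> j; exact: bounded_measurable_bern.
congr inner; apply/funext => x; rewrite eval2_sum.
by apply: eq_bigr => j _; rewrite eval2Z.
Qed.

Theorem theorem2p3 (R : realType) (n m : nat) (alpha : 'I_3 -> R)
    (c : 'I_3 -> nat) (omega r g : nat * nat -> R)
    (D : nat * nat -> mpoly 2 R) (E : nat * nat -> nat * nat -> R) :
  (forall i, -1 < alpha i) ->
  (\sum_(i < 3) c i < m)%N ->
  (forall k, k \in Theta n -> 0 < omega k) ->
  dual_bernstein alpha c m D ->
  bezier_coefs c m D E ->
  forall p : nat * nat -> R,
    constrained_minimiser alpha c n m omega r g p <->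
    (forall k, k \in Gam c m -> p k = g k) /\
    (forall k, k \in Omega c m ->
       p k = \sum_(l <- Omega c m)
               tbinom R m l * E k l
               * (u_coef alpha n m omega r l - v_coef alpha c m g l)).
Proof.
move=> alpha_gt _ omega_gt0 dual coefs p.
rewrite constrained_minimiserP//.
pose G k l := inner alpha (eval2 (bern R m k)) (eval2 (bern R m l)).
pose b l := tbinom R m l * (u_coef alpha n m omega r l - v_coef alpha c m g l).
have GC k l : k \in Omega c m -> l \in Omega c m -> G k l = G l k.
  by move=> _ _; exact: innerC.
have solve := normal_equations_solution GC
  (bezier_coefs_left_inverse alpha_gt dual coefs) p b.
have sumE k : \sum_(l <- Omega c m) tbinom R m l * E k l
    * (u_coef alpha n m omega r l - v_coef alpha c m g l) =
    \sum_(l <- Omega c m) b l * E k l.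
  by apply: eq_bigr => l _; rewrite /b; ring.
split=> -[pg h]; split=> //.
- move=> k kO; rewrite sumE; move: k kO; apply/solve => l lO.
  have := h _ lO.
  rewrite (residual_bern r alpha_gt omega_gt0 pg (Omega_Theta lO)).
  by move/eqP; rewrite subr_eq0 => /eqP.
- move=> l lO; rewrite (residual_bern r alpha_gt omega_gt0 pg (Omega_Theta lO)).
  apply/eqP; rewrite subr_eq0; apply/eqP/esym.
  by move: l lO; apply/solve => k kO; rewrite -sumE h.
Qed.
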